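(* Let $q\geqslant2$ be an even integer and $n\geqslant2$ an even integer. Let $S=\mathrm{SB}^{+}_{\mathcal{GM}^q}(n)\cup\mathrm{SB}^{-}_{\mathcal{GM}^q}(n)$ and $\mathrm{Sp}_L(S)=\{\mathrm{dist}_L(f_1,f_2): f_1,f_2\in S\}$. Then $$\mathrm{Sp}_L(S)=\{q\cdot2^{n-2}\}\cup\bigcup_{w=0}^{q/2}\bigcup_{r=0}^{n/2-1}\left\{q\cdot2^{n-2}\left(1\pm\frac{1}{2^r}\right)\mp w\cdot2^{n-r}\right\},$$ where in each expression the upper signs are taken together and the lower signs are taken together.
   Context: The Lee weight of $a\in\mathbb{Z}_q$ is $\mathrm{wt}_L(a)=\min\{a,q-a\}$ (with $a\in\{0,\dots,q-1\}$), and $\mathrm{dist}_L(f,g)=\sum_{x}\mathrm{wt}_L(f(x)-g(x))$. $\mathrm{SB}^{+}_{\mathcal{GM}^q}(n)$ (resp. $\mathrm{SB}^{-}_{\mathcal{GM}^q}(n)$) is the set of self-dual (resp. anti-self-dual) functions $f:\mathbb{F}_2^{n/2}\times\mathbb{F}_2^{n/2}\to\mathbb{Z}_q$ of the form $f(x,y)=\frac q2\langle x,\pi(y)\rangle+g(y)$, $\pi$ a permutation of $\mathbb{F}_2^{n/2}$, $g:\mathbb{F}_2^{n/2}\to\mathbb{Z}_q$. With $\omega=e^{2\pi i/q}$, $H_f(u)=\sum_x\omega^{f(x)}(-1)^{\langle x,u\rangle}$; $f$ is self-dual if $H_f(u)=2^{n/2}\omega^{f(u)}$ for all $u$, anti-self-dual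 if $H_f(u)=2^{n/2}\omega^{f(u)+q/2}$ for all $u$. *)

(* Defs.v *)
From HB Require Import structures.
From mathcomp Require Import all_boot all_order all_algebra all_fingroup.
From mathcomp Require Import all_classical all_reals all_analysis.
From mathcomp Require Import complex.

Set Implicit Arguments.
Unset Strict Implicit.
Unset Printing Implicit Defensive.

Import Order.TTheory GRing.Theory Num.Theory.

Local Open Scope classical_set_scope.
Local Open Scope ring_scope.

Definition dotF2 (m : nat) (x y : 'rV['F_2]_m) : 'F_2 :=
  \sum_(i < m) x ord0 i * y ord0 i.

(* A generalized Boolean function in n = 2m variables, its argument being split
   into halves.  'Z_q is the ring of integers mod q only for 1 < q, the case of
   interest here. *)
Definition gbf (q m : nat) := 'rV['F_2]_m * 'rV['F_2]_m -> 'Z_q.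

Definition dotF2_pair (m : nat) (x u : 'rV['F_2]_m * 'rV['F_2]_m) : 'F_2 :=
  dotF2 x.1 u.1 + dotF2 x.2 u.2.

Definition lee_weight (q : nat) (a : 'Z_q) : nat := minn a (q - a)%N.

Definition lee_dist (q m : nat) (f g : gbf q m) : nat :=
  (\sum_(x : 'rV['F_2]_m * 'rV['F_2]_m) lee_weight (f x - g x)%R)%N.

Definition omega (R : realType) (q : nat) : R[i] :=
  Complex (cos (2 * pi / q%:R)) (sin (2 * pi / q%:R)).

(* Residues mod q and mod 2 occurring as exponents are replaced by their
   canonical representatives in nat. *)
Definition walsh (R : realType) (q m : nat) (f : gbf q m)
    (u : 'rV['F_2]_m * 'rV['F_2]_m) : R[i] :=
  \sum_(x : 'rV['F_2]_m * 'rV['F_2]_m)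
    omega R q ^+ (f x : nat) * (-1) ^+ (dotF2_pair x u : nat).

Definition self_dual (R : realType) (q m : nat) (f : gbf q m) : Prop :=
  forall u, walsh R f u = 2 ^+ m * omega R q ^+ (f u : nat).

Definition anti_self_dual (R : realType) (q m : nat) (f : gbf q m) : Prop :=
  forall u, walsh R f u = 2 ^+ m * omega R q ^+ ((f u : nat) + q./2)%N.

Definition maiorana_mcfarland (q m : nat) (f : gbf q m) : Prop :=
  exists (p : {perm 'rV['F_2]_m}) (g : 'rV['F_2]_m -> 'Z_q),
    forall x y, f (x, y) = (q./2)%:R * (dotF2 x (p y) : nat)%:R + g y.

Definition SBplus (R : realType) (q n : nat) : set (gbf q n./2) :=
  [set f | maiorana_mcfarland f /\ self_dual R f].

Definition SBminus (R : realType) (q n : nat) : set (gbf q n./2) :=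
  [set f | maiorana_mcfarland f /\ anti_self_dual R f].

Arguments SBplus R q n : clear implicits.
Arguments SBminus R q n : clear implicits.

Definition lee_spectrum (q m : nat) (S : set (gbf q m)) : set nat :=
  [set d | exists f1 f2, [/\ S f1, S f2 & d = lee_dist f1 f2]].

(* Main.v *)
(* The (anti-)self-dual functions of the class are exactly
     f(x, y) = (q/2) (<x, L y> + <x, b> + <b, L y>) + d
   with L an isometry of the dot product of F_2^m (m = n/2), b a vector and d in
   Z_q; the parity of <b, b> separates the two kinds.  The difference of two of
   them is (q/2) h + d, where h is affine in x, so the Lee distance is an affine
   function of the character sum of h.  Summing over x first leaves the sum of an
   additive character over a coset of K = {y : L1 y = L2 y}, which is 0 or
   +-#|K|.  Isometries fix the all-ones vector, since <x, x> = <x, 1>, hence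
   #|K| = 2 ^ k with 1 <= k <= m, and r = m - k < m.  Conversely every r < m is
   realised by L1 = id and L2 a cyclic permutation of r + 1 coordinates. *)
Require Import Defs.
From mathcomp Require Import all_boot all_order all_algebra.
From mathcomp Require Import all_classical all_reals all_analysis.
From mathcomp Require Import all_fingroup complex.
From mathcomp Require Import zify ring lra.
Set Implicit Arguments.
Unset Strict Implicit.
Unset Printing Implicit Defensive.

Import Order.TTheory GRing.Theory Num.Theory.
Local Open Scope classical_set_scope.
Local Open Scope ring_scope.

(** * Bits and their signs *)

Lemma F2_cases (a : 'F_2) : a = 0 \/ a = 1.
Proof. by case: a => [[|[|//]]] h; [left|right]; apply: val_inj. Qed.

Lemma addF2_self (a : 'F_2) : a + a = 0.
Proof. by case: (F2_cases a) => ->; apply: val_inj. Qed.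

Lemma addF2_eq0 (a b : 'F_2) : (a + b == 0) = (a == b).
Proof. by case: (F2_cases a) => ->; case: (F2_cases b) => ->. Qed.

Definition sgn2 (F : numDomainType) (a : 'F_2) : F := (-1) ^+ (a : nat).

Lemma sgn2D (F : numDomainType) (a b : 'F_2) :
  sgn2 F (a + b) = sgn2 F a * sgn2 F b.
Proof.
by case: (F2_cases a) => ->; case: (F2_cases b) => ->;
  rewrite /sgn2 /= ?expr0 ?expr1 ?mulr1 ?mul1r ?mulrNN ?mulr1.
Qed.

(** * The dot product on F_2^m, character sums and isometries *)

Section Dot.
Variable m : nat.
Local Notation V := 'rV['F_2]_m.
Implicit Types x y z : V.

Lemma dotC x y : dotF2 x y = dotF2 y x.
Proof. by apply: eq_bigr => i _; rewrite mulrC. Qed.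

Lemma dotDl x y z : dotF2 (x + y) z = dotF2 x z + dotF2 y z.
Proof.
by rewrite /dotF2 -big_split; apply: eq_bigr => i _; rewrite !mxE mulrDl.
Qed.

Lemma dotDr x y z : dotF2 x (y + z) = dotF2 x y + dotF2 x z.
Proof. by rewrite dotC dotDl !(dotC x). Qed.

Lemma dot0r x : dotF2 x 0 = 0.
Proof. by apply: big1 => i _; rewrite !mxE mulr0. Qed.

Lemma addV_self x : x + x = 0.
Proof. by apply/rowP => i; rewrite !mxE addF2_self. Qed.

Lemma addV_eq0 x y : (x + y == 0) = (x == y).
Proof.
apply/eqP/eqP => [h|->]; last exact: addV_self.
by rewrite -[x]addr0 -(addV_self y) addrA h add0r.
Qed.

Lemma dot_delta i y : dotF2 (delta_mx ord0 i) y = y ord0 i.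
Proof.
rewrite /dotF2 (bigD1 i) //= big1 => [|j ji]; rewrite !mxE ?eqxx.
  by rewrite mul1r addr0.
by rewrite (negbTE ji) mul0r.
Qed.

Lemma dot_nondeg y z : (forall x, dotF2 x y = dotF2 x z) -> y = z.
Proof. by move=> h; apply/rowP => i; rewrite -!dot_delta h. Qed.

Lemma dot_ones x : dotF2 x (const_mx 1) = dotF2 x x.
Proof.
apply: eq_bigr => i _; rewrite mxE mulr1.
by case: (F2_cases (x ord0 i)) => ->; apply: val_inj.
Qed.

(** Translation by [k] permutes the index set and flips every sign, so the sum equals its own
    opposite. *)
Lemma sum_sgn2_flip (F : numDomainType) (P : pred V) (e : V -> 'F_2) k :
  (forall y, P (k + y) = P y) -> (forall y, e (k + y) = 1 + e y) ->
  \sum_(y | P y) sgn2 F (e y) = 0.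
Proof.
move=> Pk ek; set S := LHS.
suff /eqP : S = - S by rewrite -addr_eq0 -mulr2n mulrn_eq0 => /eqP.
rewrite {1}/S (reindex_inj (addrI k)) /= -sumrN.
by apply: eq_big => [y|y _]; rewrite ?Pk // ek sgn2D /sgn2 /= mulN1r.
Qed.

Lemma cardV : #|{: V}| = (2 ^ m)%N.
Proof. by rewrite card_mx card_Fp // mul1n. Qed.

Lemma sum_sgn2_dot (F : numDomainType) y :
  \sum_x sgn2 F (dotF2 x y) = if y == 0 then 2 ^+ m else 0.
Proof.
case: eqVneq => [->|y0].
  rewrite (eq_bigr (fun=> 1)) => [|x _]; last by rewrite dot0r.
  by rewrite sumr_const cardV natrX.
have [i yi] : exists i, y ord0 i = 1.
  have [i yi] := rV0Pn _ y0; exists i; move: yi.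
  by case: (F2_cases (y ord0 i)) => -> //; rewrite eqxx.
apply: (@sum_sgn2_flip F predT (fun x => dotF2 x y) (delta_mx ord0 i)) => // x.
by rewrite dotDl dot_delta yi.
Qed.

Definition dot_preserving (L : V -> V) :=
  forall x y, dotF2 (L x) (L y) = dotF2 x y.

Section DotPreserving.
Variables (L : V -> V) (LP : dot_preserving L).

Lemma dot_preserving_inj : injective L.
Proof. by move=> x y Lxy; apply: dot_nondeg => z; rewrite -LP Lxy LP. Qed.

(** An injective self-map of a finite set is onto, so the vectors [L x] exhaust the space. *)
Lemma dot_preserving_nondeg y z :
  (forall x, dotF2 (L x) y = dotF2 (L x) z) -> y = z.
Proof.
move=> h; apply: dot_nondeg => x.
by have [L' _ L'K] := injF_bij dot_preserving_inj; rewrite -(L'K x) h.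
Qed.

(** Both sides have the same dot product with every [L z]. *)
Lemma dot_preservingD x y : L (x + y) = L x + L y.
Proof.
by apply: dot_preserving_nondeg => z; rewrite dotDr !LP dotDr.
Qed.

Lemma dot_preserving_ones : L (const_mx 1) = const_mx 1.
Proof.
by apply: dot_preserving_nondeg => z; rewrite LP !dot_ones LP.
Qed.

End DotPreserving.
End Dot.

(** * The subgroup {0, q/2} of Z_q and Lee weights *)

Section Half.
Variable q : nat.
Hypotheses (q_ge2 : (2 <= q)%N) (q_even : ~~ odd q).

Lemma val_ZqD (a b : 'Z_q) : ((a + b)%R : nat) = ((a + b) %% q)%N.
Proof. by rewrite /= [X in (_ %% X)%N]Zp_cast. Qed.

Lemma ltn_Zq (a : 'Z_q) : (a < q)%N.
Proof. by rewrite -[X in (_ < X)%N](Zp_cast q_ge2) ltn_ord. Qed.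

(** For even q, the additive embedding of F_2 into Z_q with image {0, q/2}. *)
Definition half (a : 'F_2) : 'Z_q := (q./2)%:R * (a : nat)%:R.

Lemma half0 : half 0 = 0.
Proof. by rewrite /half mulr0. Qed.

Lemma half1 : half 1 = (q./2)%:R.
Proof. by rewrite /half mulr1. Qed.

Lemma val_half1 : (half 1 : nat) = q./2.
Proof. by rewrite half1 val_Zp_nat // modn_small; lia. Qed.

Lemma halfD a b : half (a + b) = half a + half b.
Proof.
have h11 : half 1 + half 1 = 0.
  by apply: val_inj; rewrite [LHS]val_ZqD val_half1 addnn halfK (negbTE q_even) subn0 modnn.
case: (F2_cases a) => ->; case: (F2_cases b) => ->; rewrite ?(half0, add0r, addr0) //.
by rewrite addF2_self half0.
Qed.

Lemma half_inj : injective half.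
Proof.
have h1 : half 1 <> 0 by move/(congr1 (@nat_of_ord _)); rewrite val_half1 /=; lia.
by move=> a b; case: (F2_cases a) => ->; case: (F2_cases b) => ->; rewrite ?half0 // => /esym.
Qed.

Lemma halfN a : - half a = half a.
Proof. by apply/eqP; rewrite eq_sym -addr_eq0 -halfD addF2_self half0. Qed.

(** Adding q/2 replaces a Lee weight W by q/2 - W, a reflection about q/4; a sign in front of W -
    q/4 covers both values of [a]. *)
Lemma lee_weight_half (F : realFieldType) (d : 'Z_q) a :
  (lee_weight (half a + d))%:R =
  q%:R / 4 + sgn2 F a * ((lee_weight d)%:R - q%:R / 4) :> F.
Proof.
have qE : q%:R = (q./2)%:R * 2 :> F by rewrite -natrM; congr _%:R; lia.
case: (F2_cases a) => ->.
  by rewrite half0 add0r /sgn2 expr0 mul1r addrC subrK.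
have /(congr1 (fun k => k%:R : F)) :
    (lee_weight (half 1 + d)%R + lee_weight d = q./2)%N.
  rewrite /lee_weight val_ZqD val_half1; have := ltn_Zq d.
  move: (d : nat) => {}d dq.
  have [dh|dh] := ltnP (q./2 + d) q; first by rewrite modn_small //; lia.
  have -> : ((q./2 + d) %% q = d - q./2)%N.
    by rewrite -[in LHS](subnK dh) modnDr modn_small; lia.
  by lia.
by rewrite natrD qE /sgn2 expr1; lra.
Qed.

End Half.

(** * Powers of the root of unity *)

Section Omega.
Variables (R : realType) (q : nat).
Hypotheses (q_ge2 : (2 <= q)%N) (q_even : ~~ odd q).
Local Notation w := (omega R q).

Lemma omegaX k :
  w ^+ k = Complex (cos (k%:R * (2 * pi / q%:R))) (sin (k%:R * (2 * pi / q%:R))).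
Proof.
rewrite /omega; move: (2 * pi / q%:R) => t.
elim: k => [|k IH]; first by rewrite expr0 mul0r cos0 sin0.
rewrite exprS IH -natr1 mulrDl mul1r cosD sinD.
simpc; congr Complex; ring.
Qed.

Lemma omegaX_half : w ^+ q./2 = -1.
Proof.
have q0 : q%:R != 0 :> R by rewrite pnatr_eq0; lia.
have -> : (-1 : R[i]) = Complex (-1) 0 by simpc.
rewrite omegaX; have -> : (q./2)%:R * (2 * pi / q%:R) = pi :> R.
  have {2}-> : q = (q./2 * 2)%N by lia.
  by rewrite natrM; field; rewrite pnatr_eq0; lia.
by rewrite cospi sinpi.
Qed.

Lemma omegaX_q : w ^+ q = 1.
Proof.
have {2}-> : q = (q./2 * 2)%N by lia.
by rewrite exprM omegaX_half sqrrN expr1n.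
Qed.

(** With t = k pi / q strictly between 0 and pi, the real part is cos 2t = 1 - 2 sin^2 t < 1. *)
Lemma omegaX_neq1 k : (0 < k < q)%N -> w ^+ k <> 1.
Proof.
move=> /andP[k0 kq]; rewrite omegaX => -[+ _].
have q0 : 0 < q%:R :> R by rewrite ltr0n; lia.
set t := k%:R * (pi / q%:R) : R.
have -> : k%:R * (2 * pi / q%:R) = t *+ 2 by rewrite /t; ring.
have : 0 < sin t.
  apply: sin_gt0_pi; rewrite /t mulr_gt0 ?ltr0n ?divr_gt0 ?pi_gt0 //=.
  rewrite mulrCA gtr_pMr ?pi_gt0 // ltr_pdivrMr // mul1r ltr_nat; lia.
rewrite cos_mulr2n cos2sin2 => s0 h.
have : 0 < sin t ^+ 2 by rewrite exprn_gt0.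
by move: h; rewrite /=; lra.
Qed.

Lemma omegaXD (a b : 'Z_q) : w ^+ ((a + b)%R : nat) = w ^+ a * w ^+ b.
Proof. by rewrite val_ZqD // expr_mod ?omegaX_q // exprD. Qed.

Lemma omegaX_inj (a b : 'Z_q) : w ^+ (a : nat) = w ^+ (b : nat) -> a = b.
Proof.
move=> h; have wb : w ^+ (b : nat) != 0.
  have : w ^+ (b : nat) * w ^+ ((- b)%R : nat) = 1 by rewrite -omegaXD subrr expr0.
  by apply: contra_eq_neq => ->; rewrite mul0r eq_sym oner_eq0.
have w1 : w ^+ ((a - b)%R : nat) = 1.
  by apply: (mulIf wb); rewrite -omegaXD subrK h mul1r.
apply/eqP; rewrite -subr_eq0; apply/negPn/negP => ab.
apply: omegaX_neq1 w1; rewrite ltn_Zq // andbT lt0n.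
by apply: contra ab => /eqP ab; apply/eqP/val_inj.
Qed.

Lemma omegaX_halfE a : w ^+ (half q a : nat) = sgn2 R[i] a.
Proof.
case: (F2_cases a) => ->; first by rewrite half0.
by rewrite val_half1 // omegaX_half.
Qed.

End Omega.

(** * The self-dual and anti-self-dual functions of the class *)

Section Duality.
Variables (R : realType) (q m : nat).
Hypotheses (q_ge2 : (2 <= q)%N) (q_even : ~~ odd q).
Local Notation V := 'rV['F_2]_m.
Local Notation w := (omega R q).

Definition mm_fun (p : {perm V}) (g : V -> 'Z_q) : gbf q m :=
  fun z => half q (dotF2 z.1 (p z.2)) + g z.2.

(** Summing over the first half of the argument kills every second half [j] with [p j != p y], so
    only [j = y] survives. As [p] is onto, every point has the form [(p y, v)]. *)
Lemma walsh_mm p g y v :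
  walsh R (mm_fun p g) (p y, v) =
  2 ^+ m * w ^+ (g y + half q (dotF2 y v) : 'Z_q)%R.
Proof.
rewrite omegaXD // omegaX_halfE // /walsh.
rewrite -(pair_big xpredT xpredT (fun x1 x2 => w ^+ (mm_fun p g (x1, x2) : nat) *
  (-1) ^+ (dotF2_pair (x1, x2) (p y, v) : nat))) /= exchange_big /=.
have E (j i : V) : w ^+ (mm_fun p g (i, j) : nat) *
    (-1) ^+ (dotF2_pair (i, j) (p y, v) : nat) =
    w ^+ (g j : nat) * sgn2 R[i] (dotF2 j v) * sgn2 R[i] (dotF2 i (p j + p y)).
  rewrite -[(-1) ^+ _]/(sgn2 R[i] (dotF2 i (p y) + dotF2 j v)).
  by rewrite omegaXD // omegaX_halfE // dotDr !sgn2D /=; ring.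
under eq_bigr => j _ do (under eq_bigr => i _ do rewrite E).
rewrite (bigD1 y) //= [X in _ + X]big1 ?addr0 => [|j jy].
  by rewrite -mulr_sumr sum_sgn2_dot addV_self eqxx mulrC.
by rewrite -mulr_sumr sum_sgn2_dot addV_eq0 (inj_eq perm_inj) (negbTE jy) mulr0.
Qed.

(** Compares exponents of omega at the points [(p y, v)]. The bit [e] treats both kinds at once: 0
    for self-dual, 1 for anti-self-dual. *)
Lemma walsh_mmP p g e :
  (forall u, walsh R (mm_fun p g) u =
     2 ^+ m * w ^+ (mm_fun p g u + half q e : 'Z_q)%R) <->
  (forall y v, g y + half q (dotF2 y v) = half q (dotF2 (p y) (p v) + e) + g v).
Proof.
split=> [h y v|h [u v]].
  have two0 : (2 : R[i]) ^+ m != 0 by rewrite expf_neq0 // pnatr_eq0.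
  have := h (p y, v); rewrite walsh_mm => /(mulfI two0)/(omegaX_inj q_ge2 q_even) ->.
  by rewrite /mm_fun /fst /snd halfD // addrAC.
rewrite -(permKV p u) walsh_mm h /mm_fun /fst /snd halfD //; congr (_ * _ ^+ _).
by rewrite addrAC.
Qed.

Lemma self_dualE (f : gbf q m) : self_dual R f <->
  forall u, walsh R f u = 2 ^+ m * w ^+ (f u + half q 0 : 'Z_q)%R.
Proof. by split=> h u; rewrite h half0 addr0. Qed.

Lemma anti_self_dualE (f : gbf q m) : anti_self_dual R f <->
  forall u, walsh R f u = 2 ^+ m * w ^+ (f u + half q 1 : 'Z_q)%R.
Proof. by split=> h u; rewrite h omegaXD // val_half1 // exprD. Qed.

Definition dual_form (L : V -> V) (b : V) (d : 'Z_q) : gbf q m :=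
  fun z => half q (dotF2 z.1 (L z.2) + dotF2 z.1 b + dotF2 b (L z.2)) + d.

(* Write [p y = L y + b] with [b = p 0]; the parity of [b] decides between
   self-duality and anti-self-duality. *)
Lemma mm_dual_form (p : {perm V}) g e :
  (forall y v, g y + half q (dotF2 y v) = half q (dotF2 (p y) (p v) + e) + g v) ->
  exists L b d, dot_preserving L /\ mm_fun p g = dual_form L b d.
Proof.
move=> h; pose b := p 0; pose L y := p y + b.
(* The identity at y = v = 0 fixes the parity of [b]; its instances with second argument 0 then
   determine [g] up to [g 0]. *)
have be : dotF2 b b = e.
  have := h 0 0; rewrite dot0r half0 addr0 -{1}[g 0]add0r => /addIr.
  rewrite -(half0 q) => /(half_inj q_ge2 q_even) /esym/eqP.
  by rewrite addF2_eq0 => /eqP.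
have gE v : g v = half q (dotF2 b (L v)) + g 0.
  have := h v 0; rewrite dot0r half0 addr0 => ->.
  by rewrite /L dotDr be dotC.
have pE y : p y = L y + b by rewrite /L -addrA addV_self addr0.
clearbody L b; exists L, b, (g 0); split; last first.
  apply: funext => -[x y]; rewrite /mm_fun /dual_form /fst /snd gE addrA.
  by rewrite -halfD // -dotDr -pE.
(* Once [g] and [p] are expanded, all terms cancel mod 2 except [dotF2 (L y) (L v)] and
   [dotF2 y v]. *)
move=> y v; have := h y v.
rewrite gE (gE v) addrAC addrA -!halfD // => /addIr/(half_inj q_ge2 q_even).
rewrite !pE !dotDl !dotDr be (dotC (L y) b).
move: (dotF2 (L y) (L v)) (dotF2 y v) (dotF2 b (L y)) (dotF2 b (L v)) => s t u' u.
case: (F2_cases s) => ->; case: (F2_cases t) => ->; case: (F2_cases u) => ->;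
  by case: (F2_cases u') => ->; case: (F2_cases e) => ->.
Qed.

(** The permutation is [y |-> L y + b], and [g] collects the terms free of x; <b, b> takes the place
    of the bit [e] of [walsh_mmP]. *)
Lemma dual_form_mm L b d : dot_preserving L ->
  exists p g, dual_form L b d = mm_fun p g /\
  forall y v, g y + half q (dotF2 y v) =
              half q (dotF2 (p y) (p v) + dotF2 b b) + g v.
Proof.
move=> LP; have pI : injective (fun y => L y + b).
  by move=> x y /addIr /(dot_preserving_inj LP).
exists (perm pI), (fun y => half q (dotF2 b (L y)) + d); split.
  apply: funext => -[x y]; rewrite /mm_fun /dual_form /fst /snd permE addrA.
  by rewrite -halfD // dotDr.
move=> y v; rewrite !permE; cbv beta; rewrite addrA [LHS]addrAC -!halfD //; congr (half q _ + d).
rewrite !dotDl !dotDr LP (dotC (L y) b).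
move: (dotF2 b b) (dotF2 y v) (dotF2 b (L y)) (dotF2 b (L v)) => e t u' u.
case: (F2_cases e) => ->; case: (F2_cases t) => ->;
  by case: (F2_cases u) => ->; case: (F2_cases u') => ->; apply: val_inj.
Qed.

Lemma dual_formP (f : gbf q m) :
  (maiorana_mcfarland f /\ self_dual R f) \/
  (maiorana_mcfarland f /\ anti_self_dual R f) <->
  exists L b d, dot_preserving L /\ f = dual_form L b d.
Proof.
have mmE p g : (forall x y, f (x, y) =
    (q./2)%:R * (dotF2 x (fun_of_perm p y) : nat)%:R + g y) -> f = mm_fun p g.
  by move=> h; apply: funext => -[x y]; exact: h.
split=> [[|] [[p [g /mmE->]]]|[L [b [d [/dual_form_mm -/(_ b d)[p [g [-> h]]] ->]]]]].
- by move=> /self_dualE /walsh_mmP /mm_dual_form.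
- by move=> /anti_self_dualE /walsh_mmP /mm_dual_form.
have pmm : maiorana_mcfarland (mm_fun p g) by exists p, g.
have := h; case: (F2_cases (dotF2 b b)) => -> /walsh_mmP.
- by move=> /self_dualE; left.
- by move=> /anti_self_dualE; right.
Qed.

End Duality.

(** * Character sums over cosets of a kernel *)

Section Kernel.
Variable m : nat.
Local Notation V := 'rV['F_2]_m.
Variable A : V -> V.
Hypothesis AD : {morph A : x y / x + y}.

Let A0 : A 0 = 0.
Proof. by have := AD 0 0; rewrite addr0 addV_self. Qed.

(** The kernel is a subgroup of F_2^m, so its order divides 2^m; it contains 0 and the all-ones
    vector, distinct since m > 0, whence k > 0. *)
Lemma card_kernel : (0 < m)%N -> A (const_mx 1) = 0 ->
  exists k, (0 < k <= m)%N /\ #|[set y | A y == 0]%SET| = (2 ^ k)%N.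
Proof.
move=> m0 A1; set K := [set y | A y == 0]%SET.
have gK : group_set K.
  apply/group_setP; split=> [|x y]; rewrite !inE /= ?A0 //.
  by rewrite AD => /eqP-> /eqP->; rewrite addr0.
have : (#|group gK| %| 2 ^ m)%N.
  by rewrite -cardV -cardsT; exact: cardSg (finset.subsetT (group gK)).
case/(dvdn_pfactor _ _ (isT : prime 2)) => k km /= Kk.
exists k; split=> //; rewrite km andbT lt0n; apply/eqP => k0.
suff : (1 < #|K|)%N by rewrite Kk k0.
apply/card_gt1P; exists 0, (const_mx 1); rewrite !inE A0 A1; split=> //.
apply/eqP => /rowP/(_ (Ordinal m0)); rewrite !mxE => /esym/eqP.
by rewrite oner_eq0.
Qed.

(** If [e] takes the value 1 on the kernel, a kernel translation flips all signs. Otherwise [e] is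
    constant on the solution set of [A y = c], which is empty or a coset of the kernel. *)
Lemma sum_sgn2_coset (F : numDomainType) (e : V -> 'F_2) c :
    {morph e : x y / x + y} ->
  let S := \sum_(y | A y == c) sgn2 F (e y) in
  let k := #|[set y | A y == 0]%SET|%:R in
  [\/ S = 0, S = k | S = - k].
Proof.
move=> eD S k.
have [[z [Az ez]]|noz] := pselect (exists z, A z = 0 /\ e z = 1).
  constructor 1; apply: (@sum_sgn2_flip _ _ _ _ z) => y; last by rewrite eD ez.
  by rewrite AD Az add0r.
have [[y0 Ay0]|noy] := pselect (exists y, A y = c); last first.
  by constructor 1; apply: big1 => y /eqP Ay; case: noy; exists y.
have -> : S = sgn2 F (e y0) * k.
  rewrite /S (reindex_inj (addrI y0)) /= /k -sum1_card natr_sum mulr_sumr.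
  apply: eq_big => [y|y]; rewrite AD Ay0 ?inE.
    by rewrite -{2}[c]addr0 (inj_eq (addrI c)).
  rewrite -{2}[c]addr0 (inj_eq (addrI c)) => /eqP Ay.
  case: (F2_cases (e y)) => ey; last by case: noz; exists y.
  by rewrite eD ey addr0 mulr1.
case: (F2_cases (e y0)) => ->; rewrite /sgn2 ?expr0 ?expr1 ?mul1r ?mulN1r;
  by [constructor 2|constructor 3].
Qed.

End Kernel.

(** * The Lee distance as a character sum *)

Lemma lee_weight_le q (d : 'Z_q) : (lee_weight d <= q./2)%N.
Proof. by rewrite /lee_weight; lia. Qed.

Section Distance.
Variables (F : realFieldType) (q m : nat).
Hypotheses (q_ge2 : (2 <= q)%N) (q_even : ~~ odd q).
Local Notation V := 'rV['F_2]_m.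

Lemma lee_dist_dual_form (L1 L2 : V -> V) b1 b2 (d1 d2 : 'Z_q) :
  (lee_dist (dual_form L1 b1 d1) (dual_form L2 b2 d2))%:R =
  (2 ^+ m) ^+ 2 * q%:R / 4 + ((lee_weight (d1 - d2))%:R - q%:R / 4) *
   (2 ^+ m * \sum_(y | L1 y + L2 y == b1 + b2)
               sgn2 F (dotF2 b1 (L1 y) + dotF2 b2 (L2 y))).
Proof.
(* The F_2-valued part of the difference; minus signs disappear because q/2 is its own opposite. The
   part linear in x vanishes exactly when [L1 y + L2 y = b1 + b2]. *)
pose h (x y : V) := dotF2 x (L1 y + L2 y + (b1 + b2)) +
  (dotF2 b1 (L1 y) + dotF2 b2 (L2 y)).
have fE z : dual_form L1 b1 d1 z - dual_form L2 b2 d2 z =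
    half q (h z.1 z.2) + (d1 - d2).
  rewrite /dual_form /h !dotDr opprD addrACA halfN // -halfD //; congr (half q _ + _).
  rewrite -!addrA; congr (_ + _); rewrite !addrA.
  move: (dotF2 z.1 b1) (dotF2 b1 _) (dotF2 z.1 (L2 _)) (dotF2 z.1 b2) (dotF2 b2 _).
  by move=> t u v s r; ring.
rewrite /lee_dist natr_sum.
under eq_bigr do rewrite fE lee_weight_half //.
rewrite big_split /= sumr_const card_prod !cardV -mulr_suml.
have -> : \sum_z sgn2 F (h z.1 z.2) = 2 ^+ m *
    \sum_(y | L1 y + L2 y == b1 + b2) sgn2 F (dotF2 b1 (L1 y) + dotF2 b2 (L2 y)).
  rewrite -(pair_big xpredT xpredT (fun x y => sgn2 F (h x y))) /= exchange_big /=.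
  rewrite mulr_sumr [RHS]big_mkcond; apply: eq_bigr => y _.
  under eq_bigr do rewrite sgn2D.
  rewrite -mulr_suml sum_sgn2_dot addV_eq0.
  by case: eqP; rewrite ?mul0r.
by rewrite -[_ *+ _]mulr_natr natrM natrX; ring.
Qed.

Lemma lee_weight_nat k : (k <= q./2)%N -> lee_weight (k%:R : 'Z_q) = k.
Proof. by move=> kq; rewrite /lee_weight val_Zp_nat // modn_small; lia. Qed.

End Distance.

(** * Isometries with a prescribed number of fixed vectors *)

(** Permuting coordinates preserves the dot product. A cycle on coordinates 0..r fixes exactly the
    vectors constant there, leaving m - r free entries. *)
Lemma cyclic_dot_preserving m r : (r < m)%N ->
  exists L : 'rV['F_2]_m -> 'rV['F_2]_m,
    dot_preserving L /\ #|[set y | y + L y == 0]%SET| = (2 ^ (m - r))%N.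
Proof.
case: m => // m rm.
pose s (i : 'I_m.+1) : 'I_m.+1 :=
  inord (if (i < r)%N then i.+1 else if i == r :> nat then 0%N else i).
have sE i : s i = (if (i < r)%N then i.+1 else if i == r :> nat then 0%N else i) :> nat.
  by rewrite inordK //; have := ltn_ord i; case: ifP => [|_]; [lia|case: eqP; lia].
have s_inj : injective s.
  move=> i j /(congr1 (@nat_of_ord _)); rewrite !sE => h; apply: val_inj => /=.
  by move: h; do 2 (case: ifP => [?|?]; [|case: eqP => ?]); lia.
exists (fun y => \row_i y ord0 (s i)); split.
  by move=> x y; rewrite [RHS](reindex_inj s_inj); apply: eq_bigr => i _; rewrite !mxE.
pose t := (m - r)%N.
have -> : (m.+1 - r = t.+1)%N by rewrite /t; lia.
(* Truncated subtraction sends every i <= r to 0, so [f] repeats the first entry of [z] on the whole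
   cycle and its image is the fixed space. *)
pose f (z : 'rV['F_2]_t.+1) : 'rV['F_2]_m.+1 := \row_i z ord0 (inord (i - r)).
have f_inj : injective f.
  move=> z1 z2 /rowP h; apply/rowP => j.
  have jr : (j + r < m.+1)%N by have := ltn_ord j; rewrite /t; lia.
  have := h (Ordinal jr); rewrite !mxE /= addnK.
  by rewrite inord_val.
rewrite -cardV -(card_imset _ f_inj); apply: eq_card => y.
rewrite inE addV_eq0; apply/eqP/imsetP => [ys|[z _ ->]].
  have yc i : (i <= r)%N -> y ord0 (inord i) = y ord0 (inord r).
    (* Descending induction along the cycle, from r to r - l; past l = r the truncated index stays
       at 0. *)
    move=> ir; rewrite -(subKn ir); elim: (r - i)%N => [|l IH]; first by rewrite subn0.
    have [lr|lr] := leqP r l; first by rewrite -IH; congr (y _ (inord _)); lia.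
    rewrite -IH {1}ys mxE; congr (y _ _); apply: val_inj; rewrite [LHS]sE [RHS]inordK ?inordK; try lia.
    by case: ifP; lia.
  exists (\row_j y ord0 (inord (j + r))) => //.
  apply/rowP => i; have im := ltn_ord i.
  rewrite !mxE inordK; last by rewrite /t; lia.
  have [ir|ir] := leqP i r.
    by rewrite (_ : i - r + r = r)%N; [rewrite -(yc _ ir) inord_val|lia].
  by rewrite subnK ?inord_val // ltnW.
apply/rowP => i; rewrite !mxE; congr (z _ (inord _)).
by rewrite sE; case: ifP => [|_]; [lia|case: eqP; lia].
Qed.

(** * The spectrum: both inclusions *)

Theorem theorem2 (R : realType) (q n : nat)
    (q_ge2 : (2 <= q)%N) (q_even : ~~ odd q)
    (n_ge2 : (2 <= n)%N) (n_even : ~~ odd n) :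
  [set (d%:R : R) | d in lee_spectrum (SBplus R q n `|` SBminus R q n)] =
  [set q%:R * 2 ^+ (n - 2)] `|`
  \bigcup_(w < (q./2).+1) \bigcup_(r < n./2)
    ([set q%:R * 2 ^+ (n - 2) * (1 + 1 / 2 ^+ r) - w%:R * 2 ^+ (n - r)] `|`
     [set q%:R * 2 ^+ (n - 2) * (1 - 1 / 2 ^+ r) + w%:R * 2 ^+ (n - r)]).
Proof.
pose m := n./2.
have m0 : (0 < m)%N by rewrite /m; lia.
have pow_n2 : 2 ^+ (n - 2) = (2 ^+ m) ^+ 2 / 4 :> R.
  apply: (canRL (mulfK _)); first by rewrite pnatr_eq0.
  have -> : 4 = 2 ^+ 2 :> R by ring.
  by rewrite -exprD -exprM; congr (_ ^+ _); rewrite /m; lia.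
have pow_nr r : (r < m)%N ->
    2 ^+ (n - r) = 2 ^+ m * 2 ^+ (m - r) :> R /\ 2 ^+ m = 2 ^+ r * 2 ^+ (m - r) :> R.
  by move=> rm; split; rewrite -exprD; congr (_ ^+ _); rewrite /m in rm *; lia.
(* A character sum 2^(m - r) yields the lower-sign value; its opposite, in [valueB], yields the
   upper-sign one. *)
have valueD r (W : R) : (r < m)%N ->
    (2 ^+ m) ^+ 2 * q%:R / 4 + (W - q%:R / 4) * (2 ^+ m * 2 ^+ (m - r)) =
    q%:R * 2 ^+ (n - 2) * (1 - 1 / 2 ^+ r) + W * 2 ^+ (n - r).
  move=> /pow_nr[E1 E2]; rewrite pow_n2 E1 E2; field.
  by rewrite expf_neq0 // pnatr_eq0.
have valueB r (W : R) : (r < m)%N ->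
    (2 ^+ m) ^+ 2 * q%:R / 4 + (W - q%:R / 4) * (2 ^+ m * - 2 ^+ (m - r)) =
    q%:R * 2 ^+ (n - 2) * (1 + 1 / 2 ^+ r) - W * 2 ^+ (n - r).
  move=> /pow_nr[E1 E2]; rewrite pow_n2 E1 E2; field.
  by rewrite expf_neq0 // pnatr_eq0.
have id_dot : dot_preserving (@id 'rV['F_2]_m) by [].
apply/seteqP; split=> [_ [_ [f1 [f2 [S1 S2 ->]]] <-]|x].
  have [L1 [b1 [d1 [LP1 ->]]]] := (dual_formP R q_ge2 q_even f1).1 S1.
  have [L2 [b2 [d2 [LP2 ->]]]] := (dual_formP R q_ge2 q_even f2).1 S2.
  rewrite lee_dist_dual_form //.
  set e := fun y => dotF2 b1 (L1 y) + dotF2 b2 (L2 y).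
  have AD : {morph (fun y => L1 y + L2 y) : x y / x + y}.
    by move=> x y; rewrite (dot_preservingD LP1) (dot_preservingD LP2) addrACA.
  have eD : {morph e : x y / x + y}.
    by move=> x y; rewrite /e (dot_preservingD LP1) (dot_preservingD LP2) !dotDr addrACA.
  have [|k [/andP[k0 km] Kk]] := card_kernel AD m0.
    by rewrite (dot_preserving_ones LP1) (dot_preserving_ones LP2) addV_self.
  have wq := lee_weight_le (d1 - d2).
  (* The parameter r is the codimension m - k of the kernel; k > 0 gives r < m. *)
  have rm : (m - k < m)%N by lia.
  have km' : (m - (m - k))%N = k by lia.
  case: (sum_sgn2_coset AD R (b1 + b2) eD) => ->; rewrite ?Kk ?natrX.
  - by left; rewrite pow_n2 !mulr0 addr0 /=; ring.
  - right; exists (lee_weight (d1 - d2)) => //; exists (m - k)%N => //; right.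
    by rewrite -valueD ?km'.
  - right; exists (lee_weight (d1 - d2)) => //; exists (m - k)%N => //; left.
    by rewrite -valueB ?km'.
have inS L b d : dot_preserving L -> (SBplus R q n `|` SBminus R q n) (@dual_form q m L b d).
  by move=> LP; apply/(dual_formP R q_ge2 q_even); exists L, b, d.
have attained w r : (w <= q./2)%N -> (r < m)%N ->
    [set (d%:R : R) | d in lee_spectrum (SBplus R q n `|` SBminus R q n)]
    (q%:R * 2 ^+ (n - 2) * (1 - 1 / 2 ^+ r) + w%:R * 2 ^+ (n - r)).
  move=> wq rm; have [L [LP cardL]] := cyclic_dot_preserving rm.
  (* With b1 = b2 = 0 every sign is +1, so the sum counts the fixed vectors of [L]; the constants
     differ by w, of Lee weight w since w <= q/2. *)
  eexists; first by exists (dual_form id 0 w%:R), (dual_form L 0 0);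
    split; [exact: inS|exact: inS|].
  rewrite lee_dist_dual_form // subr0 lee_weight_nat // -valueD //.
  congr (_ + _ * (_ * _)); rewrite addr0.
  rewrite (eq_bigr (fun=> 1)) => [|y _]; last by rewrite !(dotC 0) !dot0r addr0.
  by rewrite sumr_const -natrX -cardL; congr _%:R; apply: eq_card => y; rewrite inE.
case=> [->|[w /= wq [r /= rm [->|->]]]]; last exact: attained.
(* With equal isometries the condition becomes 0 = b1 + b2; the all-ones [b2] makes it unsolvable,
   so the character sum is empty. *)
- eexists; first by exists (dual_form id 0 0), (dual_form id (const_mx 1) 0);
    split; [exact: inS|exact: inS|].
  rewrite lee_dist_dual_form // big1 => [|y].
    by rewrite pow_n2 !mulr0 addr0; ring.
  rewrite addV_self add0r => /eqP/rowP/(_ (Ordinal m0))/eqP.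
  by rewrite !mxE eq_sym oner_eq0.
(* The upper-sign value at [w] is the lower-sign value at [q/2 - w]. *)
have -> : q%:R * 2 ^+ (n - 2) * (1 + 1 / 2 ^+ r) - w%:R * 2 ^+ (n - r) =
    q%:R * 2 ^+ (n - 2) * (1 - 1 / 2 ^+ r) + (q./2 - w)%:R * 2 ^+ (n - r) :> R.
  have qE : q%:R = (q./2)%:R * 2 :> R by rewrite -natrM; congr _%:R; lia.
  by rewrite -valueD // -valueB // natrB // qE; field.
by apply: attained; rewrite ?leq_subr.
Qed.
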